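(* Let $\mathcal{D}=(V,E,F)$ be an infinite cellular decomposition of a non-compact surface $S$. In hyperbolic background geometry, if $\Theta\in(0,\pi)^E$ satisfies condition (C1) (see context), and there exists a constant $\hat c>0$ such that for all $v_i\in V$ $$\bar{\mathcal{L}}_i(\mathcal{D},\Theta):=\frac{\mathcal{L}_i(\mathcal{D},\Theta)-2\pi}{d_i}\ge\hat c,\qquad \mathcal{L}_i(\mathcal{D},\Theta):=\sum_{j\sim i}\Theta_{ij},$$ then there exists a good ideal circle pattern, i.e. a circle packing metric $r\in(0,\infty)^V$ with $K_i(r,\Theta)=0$ for all $v_i\in V$.
   Context: $V,E,F$ are the vertices, edges and faces of $\mathcal{D}$; $j\sim i$ means $v_i,v_j$ are joined by an edge $[v_i,v_j]\in E$; $d_i$ is the (finite) degree of $v_i$; the 1-skeleton $(V,E)$ is assumed connected (graph distance between any two vertices is finite). $\Theta_{ij}=\Theta([v_i,v_j])$. Condition (C1): if edges $e_1,\dots,e_m$ form the boundary of a face, then $\sum_{l=1}^m\Theta(e_l)=(m-2)\pi$. A circle packing metric is a function $r:V\to(0,\infty)$. For an edge $[v_i,v_j]$, consider the hyperbolic triangle $v_iv_jv_f$ with $|v_iv_f|=r_i$, $|v_jv_f|=r_j$ and $|v_iv_j|=l_{ij}=\cosh^{-1}(\cosh r_i\cosh r_j+\sinh r_i\sinh r_j\cos\Theta_{ij})$; let $\theta_{ij}$ be its inner angle at $v_i$. The discrete Gaussian (vertex) curvature is $2\pi$ minus the total cone angle at $v_i$, i.e. $K_i(r,\Theta)=2\pi-2\sum_{j\sim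 i}\theta_{ij}(r_i,r_j)$. *)

(* Defs.v *)
From HB Require Import structures.
From mathcomp Require Import all_boot all_order all_algebra.
From mathcomp Require Import finmap.
From mathcomp Require Import all_classical all_reals all_analysis.
Set Implicit Arguments.
Unset Strict Implicit.
Unset Printing Implicit Defensive.
Import Order.TTheory GRing.Theory Num.Theory.
Import numFieldNormedType.Exports.
Local Open Scope classical_set_scope.
Local Open Scope ring_scope.

(* Every point has an open neighbourhood homeomorphic to the plane, given as
   the range of an open topological embedding. *)
Definition locally_planar (R : realType) (S : topologicalType) : Prop :=
  forall x : S, exists phi : R * R -> S,
    [/\ continuous phi, injective phi,
        forall W : set (R * R), open W -> open (phi @` W)
      & range phi x].

Definition surface (R : realType) (S : topologicalType) : Prop :=
  [/\ hausdorff_space S, @second_countable S & locally_planar R S].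

Section Plane.
Variable R : realType.

Definition closed_disc : set (R * R) := [set p | p.1 ^+ 2 + p.2 ^+ 2 <= 1].
Definition open_disc : set (R * R) := [set p | p.1 ^+ 2 + p.2 ^+ 2 < 1].

(* The point at parameter [t] of the [k]-th of the [m] equal arcs that divide
   the unit circle. *)
Definition arc_point (m k : nat) (t : R) : R * R :=
  let a := 2 * pi * (k%:R + t) / m%:R in (cos a, sin a).

End Plane.

(* A dart [(e, b)] is the edge [e] with a chosen initial end: it runs from
   [edge_end e b] to [edge_end e (~~ b)]. Loops and multiple edges are allowed.
   The boundary of a face is an [m]-gon whose sides are glued, in cyclic order,
   to the darts of [face_word]; requiring the gluing to have constant speed on
   each of [m] equal arcs only normalizes the characteristic map of the face,
   since a homeomorphism of the circle extends to the disc.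
   Injectivity on the open disc (resp. interval) makes the characteristic map a
   homeomorphism onto the open cell, because the domain is compact, [S] is
   Hausdorff and the boundary is mapped to other cells. *)
Record cell_decomposition (R : realType) (S : topologicalType) :=
  CellDecomposition {
  vert : choiceType;
  edge : choiceType;
  face : choiceType;
  vert_point : vert -> S;
  edge_map : edge -> R -> S;
  face_map : face -> R * R -> S;
  edge_end : edge -> bool -> vert;
  face_word : face -> seq (edge * bool);

  edge_map_continuous : forall e, {within `[0, 1], continuous (edge_map e)};
  edge_map_inj : forall e, {in `]0, 1[ &, injective (edge_map e)};
  edge_map_end : forall e (b : bool),
    edge_map e (b : nat)%:R = vert_point (edge_end e b);

  face_map_continuous : forall f,
    {within @closed_disc R, continuous (face_map f)};
  face_map_inj : forall f, {in @open_disc R &, injective (face_map f)};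
  face_word_nonempty : forall f, face_word f <> [::];
  face_map_boundary : forall f (k : nat) (e : edge) (b : bool) (t : R),
    onth (face_word f) k = Some (e, b) -> 0 <= t <= 1 ->
    face_map f (arc_point (size (face_word f)) k t)
      = edge_map e (if b then 1 - t else t);

  open_cell := fun c : vert + edge + face =>
    match c with
    | inl (inl v) => [set vert_point v]
    | inl (inr e) => edge_map e @` `]0, 1[
    | inr f => face_map f @` @open_disc R
    end;
  cell_partition : forall x : S, exists! c, open_cell c x;

  (* [S] carries the weak topology of the characteristic maps (CW axiom). *)
  cell_weak_topology : forall A : set S,
    (forall e, closed (`[0, 1] `&` edge_map e @^-1` A)) ->
    (forall f, closed (@closed_disc R `&` face_map f @^-1` A)) ->
    closed A;

  star := fun v : vert => [set d : edge * bool | edge_end d.1 d.2 = v];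
  star_finite : forall v, finite_set (star v)
}.

Section Combinatorics.
Variables (R : realType) (S : topologicalType) (D : cell_decomposition R S).

Definition infinite_decomposition : Prop :=
  infinite_set [set: vert D + edge D + face D].

Definition adjacent (v w : vert D) : Prop :=
  exists d : edge D * bool,
    edge_end d.1 d.2 = v /\ edge_end d.1 (~~ d.2) = w.

Definition skeleton_connected : Prop :=
  forall v w : vert D, exists (n : nat) (p : nat -> vert D),
    [/\ p 0%N = v, p n = w & forall i, (i < n)%N -> adjacent (p i) (p i.+1)].

Definition degree (v : vert D) : nat := #|` fset_set (star v)|%fset.

Definition condition_C1 (Theta : edge D -> R) : Prop :=
  forall f : face D,
    \sum_(d <- face_word f) Theta d.1 = ((size (face_word f))%:R - 2) * pi.

Definition angle_sum (Theta : edge D -> R) (v : vert D) : R :=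
  \sum_(d \in star v) Theta d.1.

Definition mean_angle_excess (Theta : edge D -> R) (v : vert D) : R :=
  (angle_sum Theta v - 2 * pi) / (degree v)%:R.

End Combinatorics.

Section Hyperbolic.
Variable R : realType.

Definition cosh (x : R) : R := (expR x + expR (- x)) / 2.
Definition sinh (x : R) : R := (expR x - expR (- x)) / 2.
Definition arcosh (x : R) : R := ln (x + Num.sqrt (x ^+ 2 - 1)).

(* The angle between the sides [a] and [b] of a hyperbolic triangle with sides
   [a], [b], [c], by the hyperbolic law of cosines. *)
Definition hyp_angle (a b c : R) : R :=
  acos ((cosh a * cosh b - cosh c) / (sinh a * sinh b)).

Definition edge_length (Theta ri rj : R) : R :=
  arcosh (cosh ri * cosh rj + sinh ri * sinh rj * cos Theta).

(* The angle at [v_i] of the triangle [v_i v_j v_f], where [v_i v_f] has length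
   [ri] and [v_j v_f] has length [rj]. *)
Definition inner_angle (Theta ri rj : R) : R :=
  hyp_angle ri (edge_length Theta ri rj) rj.

Variables (S : topologicalType) (D : cell_decomposition R S).

Definition circle_packing_metric (r : vert D -> R) : Prop :=
  forall v, 0 < r v.

Definition curvature (Theta : edge D -> R) (r : vert D -> R) (v : vert D) : R :=
  2 * pi - 2 * \sum_(d \in star v)
    inner_angle (Theta d.1) (r v) (r (edge_end d.1 (~~ d.2))).

Definition good_ideal_circle_pattern
    (Theta : edge D -> R) (r : vert D -> R) : Prop :=
  circle_packing_metric r /\ forall v, curvature Theta r v = 0.

End Hyperbolic.

(* Main.v *)
Require Import Defs.
From HB Require Import structures.
From mathcomp Require Import all_boot all_order all_algebra.
From mathcomp Require Import ring lra.
From mathcomp Require Import all_classical all_reals all_analysis.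
Set Implicit Arguments.
Unset Strict Implicit.
Unset Printing Implicit Defensive.
Import Order.TTheory GRing.Theory Num.Theory.
Import numFieldNormedType.Exports.
Local Open Scope classical_set_scope.
Local Open Scope ring_scope.

(** The radii are found by Perron's method, directly on the infinite graph.

    The cotangent four-part formula of hyperbolic trigonometry gives the angle
    at [v_i] in the triangle [v_i v_j v_f] explicitly, by
      cot theta = (sinh r_i coth r_j + cosh r_i cos Theta) / sin Theta
    (lemma [inner_angleE]). Three facts follow. The angle grows with the
    neighbouring radius [r_j], because coth decreases ([base_angle_le]). It is
    continuous in [r_i]. It tends to 0 as [r_i] grows, uniformly in [r_j],
    because coth r_j > 1 and cos Theta > -1 ([base_angle_small]).

    A radius function is a subsolution when the angles around every vertex sum
    to at least pi, that is, when every curvature is nonpositive. A small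
    constant [e] is one: a triangle with [r_i = r_j = e] has base angles close
    to Theta / 2, with an error that depends on [e] alone and not on Theta
    ([base_angle_diag_ge]), so that the uniform excess of the angle sum over
    2 pi, per incident edge, absorbs the errors at all vertices at once. This is
    where the uniformity of the constant is essential. At each vertex the
    subsolutions above [e] are bounded, since a large radius makes the angles
    too small whatever the neighbours are. Their pointwise supremum is again a
    subsolution by monotonicity, and it has curvature zero: if the angle sum at
    some vertex exceeded pi, then increasing the radius there a little would
    give a larger subsolution ([exists_level_of_subsolution]). *)

(** * Hyperbolic functions *)

Section HyperbolicFunctions.
Variable R : realType.
Implicit Types x : R.

Lemma cosh_sqr x : cosh x ^+ 2 = 1 + sinh x ^+ 2.
Proof.
have := expRxMexpNx_1 x; rewrite /cosh /sinh => h.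
by field: h.
Qed.

Lemma sinh_gt0 x : 0 < x -> 0 < sinh x.
Proof. by move=> x0; rewrite divr_gt0// subr_gt0 ltr_expR; lra. Qed.

Lemma sinh_lt_cosh x : sinh x < cosh x.
Proof. by have := expR_gt0 (- x); rewrite /cosh /sinh; lra. Qed.

Lemma cosh_sinh_arcosh x : 1 <= x ->
  cosh (arcosh x) = x /\ sinh (arcosh x) = Num.sqrt (x ^+ 2 - 1).
Proof.
move=> x1; set s := Num.sqrt _.
have s0 : 0 <= s by exact: sqrtr_ge0.
have s2 : s ^+ 2 = x ^+ 2 - 1 by rewrite sqr_sqrtr//; nra.
have u0 : 0 < x + s by lra.
have uE : (x + s)^-1 = x - s.
  by apply: (mulfI (lt0r_neq0 u0)); rewrite mulfV ?lt0r_neq0//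
    [RHS]mulrC -subr_sqr s2; ring.
by rewrite /cosh /sinh /arcosh -/s expRN lnK ?posrE// uE; split; lra.
Qed.

Lemma exists_cosh_le (c : R) : 0 < c -> exists2 e : R, 0 < e & cosh e <= 1 + c.
Proof.
move=> c0; exists (ln (1 + c)); first by rewrite ln_gt0//; lra.
rewrite /cosh expRN lnK ?posrE; last by lra.
have : (1 + c)^-1 <= 1 by rewrite invf_le1; lra.
by lra.
Qed.

End HyperbolicFunctions.

(** * The base angles of the triangle *)

Section BaseAngle.
Variable R : realType.
Implicit Types x y Th C : R.

(** The cotangent of the angle at the end of the side of length [x], when the
    sides of lengths [x] and [y] enclose the angle [pi - Th]. *)
Definition cot_angle Th x y : R :=
  (sinh x * (cosh y / sinh y) + cosh x * cos Th) / sin Th.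

(** The arc cotangent of [cot_angle]: the extension of [inner_angle] to a function
    continuous in [x] on the whole line, which spares positivity conditions. *)
Definition base_angle Th x y : R := pi / 2 - atan (cot_angle Th x y).

Lemma cosN1_lt Th : 0 < Th < pi -> -1 < cos Th.
Proof.
move=> /andP[T0 Tp]; rewrite -cospi ltr_cos// in_itv/=; apply/andP; split; lra.
Qed.

Lemma acos_cot g : acos (g / Num.sqrt (1 + g ^+ 2)) = pi / 2 - atan g :> R.
Proof.
have lo := atan_gtNpi2 g; have hi := atan_ltpi2 g.
have c0 : 0 < cos (atan g) by apply: cos_gt0_pihalf; rewrite lo hi.
have -> : g / Num.sqrt (1 + g ^+ 2) = cos (pi / 2 - atan g).
  rewrite -cos_atan -{1}[g]atanK /tan divfK ?lt0r_neq0//.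
  by rewrite cosB cos_pihalf sin_pihalf mul0r mul1r add0r.
by rewrite cosK// in_itv/=; apply/andP; split; lra.
Qed.

(** With [l] the third side, the law of cosines gives the cosine of the angle as
    [N / sinh l], where [N = sinh x * cosh y + cosh x * sinh y * cos Th]. Since
    [sinh l ^+ 2 = N ^+ 2 + s ^+ 2] with [s = sinh y * sin Th], the cotangent is
    [N / s]. *)
Lemma inner_angleE Th x y : 0 < Th < pi -> 0 < x -> 0 < y ->
  inner_angle Th x y = base_angle Th x y.
Proof.
move=> T x0 y0; have sT : 0 < sin Th by exact: sin_gt0_pi.
have sx := sinh_gt0 x0; have sy := sinh_gt0 y0.
have kT := cosN1_lt T.
have cx := sinh_lt_cosh x; have cy := sinh_lt_cosh y.
have cx2 := cosh_sqr x; have cy2 := cosh_sqr y; have T2 := sin2cos2 Th.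
rewrite /inner_angle /hyp_angle /edge_length.
(* [X] is the hyperbolic cosine of the third side. *)
set X := (X in arcosh X).
pose N := sinh x * cosh y + cosh x * sinh y * cos Th.
pose s := sinh y * sin Th.
have s0 : 0 < s by rewrite mulr_gt0.
have X2 : X ^+ 2 - 1 = N ^+ 2 + s ^+ 2.
  by rewrite /X /N /s; ring: cx2 cy2 T2.
have X0 : 0 < X.
  rewrite (_ : X = (cosh x - sinh x) * cosh y + sinh x * (cosh y - sinh y)
                   + sinh x * sinh y * (1 + cos Th)); last by rewrite /X; ring.
  have c0 : 0 < cosh y by lra.
  have k0 : 0 < 1 + cos Th by lra.
  have dx : 0 < cosh x - sinh x by lra.
  have dy : 0 < cosh y - sinh y by lra.
  exact: addr_gt0 (addr_gt0 (mulr_gt0 dx c0) (mulr_gt0 sx dy))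
    (mulr_gt0 (mulr_gt0 sx sy) k0).
have X1 : 1 <= X.
  have : 0 <= X ^+ 2 - 1 by rewrite X2 addr_ge0 ?sqr_ge0.
  by clear -X0; nra.
have [-> ->] := cosh_sinh_arcosh X1.
rewrite X2 /base_angle -acos_cot; congr acos.
set g := cot_angle Th x y.
have gE : N = g * s.
  by rewrite /g /N /s /cot_angle; field; rewrite !lt0r_neq0.
have -> : cosh x * X - cosh y = sinh x * N.
  by rewrite /X /N; ring: cx2.
have -> : Num.sqrt (N ^+ 2 + s ^+ 2) = s * Num.sqrt (1 + g ^+ 2).
  rewrite gE (_ : _ + _ = s ^+ 2 * (1 + g ^+ 2)); last by ring.
  by rewrite sqrtrM ?sqr_ge0// sqrtr_sqr gtr0_norm.
have q0 : 0 < Num.sqrt (1 + g ^+ 2).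
  by rewrite sqrtr_gt0; have := sqr_ge0 g; lra.
by rewrite gE; field; rewrite !lt0r_neq0.
Qed.

Lemma continuous_base_angle Th y : continuous (fun x => base_angle Th x y).
Proof.
move=> x.
have ce : expR z @[z --> x] --> expR x by exact: continuous_expR.
have ceN : expR (- z) @[z --> x] --> expR (- x).
  apply: (@continuous_comp _ _ _ -%R (@expR R)); last exact: continuous_expR.
  exact: opp_continuous.
have cg : cot_angle Th z y @[z --> x] --> cot_angle Th x y.
  apply: cvgMl; apply: cvgD; apply: cvgMl; apply: cvgMl.
  - exact: cvgB.
  - exact: cvgD.
apply: cvgB; first exact: cvg_cst.
by apply: (cvg_comp _ _ cg); exact: continuous_atan.
Qed.

Lemma base_angle_le Th x y z : 0 < Th < pi -> 0 < x -> 0 < y -> y <= z ->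
  base_angle Th x y <= base_angle Th x z.
Proof.
move=> T x0 y0 yz; have z0 : 0 < z by lra.
rewrite lerB// ltW_homo//; first exact: lt_atan.
rewrite ler_pM2r ?invr_gt0 ?sin_gt0_pi// lerD2r ler_pM2l ?sinh_gt0//.
rewrite ler_pdivrMr ?sinh_gt0// mulrAC ler_pdivlMr ?sinh_gt0//.
have h1 : expR y * expR (- z) <= expR z * expR (- y).
  by rewrite ler_pM ?expR_ge0// ler_expR; lra.
by rewrite /cosh /sinh; lra.
Qed.

(** The threshold [M] does not depend on [y], because [coth y > 1] bounds the
    cotangent below by [(sinh x + cosh x * cos Th) / sin Th], which tends to
    infinity with [x] since [cos Th > -1]. *)
Lemma base_angle_small Th (eta : R) : 0 < Th < pi -> 0 < eta ->
  exists2 M, 0 <= M & forall x y, M < x -> 0 < y -> base_angle Th x y < eta.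
Proof.
move=> T eta0; have kT := cosN1_lt T; have sT : 0 < sin Th by exact: sin_gt0_pi.
(* [e <= eta / 2] makes the bound strict; [e <= pi / 4] keeps [pi / 2 - e] in
   the range where [atan] inverts [tan]. *)
pose e := Num.min eta (pi / 2) / 2.
have p0 : 0 < pi :> R by exact: pi_gt0.
have e0 : 0 < e by rewrite divr_gt0// lt_min eta0/=; lra.
have em : e <= eta / 2 /\ e <= pi / 2 / 2.
  by split; rewrite ler_pM2r ?invr_gt0// ge_min lexx ?orbT.
case: em => e1 e2.
pose t := tan (pi / 2 - e).
(* [2 * (sinh x + cosh x * k) = expR x * (1 + k) - expR (- x) * (1 - k)] is at
   least [(1 + x) * (1 + k) - (1 - k)], with [k = cos Th], so that
   [x * (1 + k) > 2 * (`|t| + 1)] suffices. *)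
exists (2 * (`|t| + 1) / (1 + cos Th)).
  by rewrite divr_ge0 ?mulr_ge0// ?addr_ge0//; lra.
move=> x y Mx y0.
have k1 : cos Th <= 1 by exact: cos_le1.
have M0 : 0 <= 2 * (`|t| + 1) / (1 + cos Th).
  by rewrite divr_ge0 ?mulr_ge0// ?addr_ge0//; lra.
have x0 : 0 < x by lra.
have num : `|t| < sinh x + cosh x * cos Th.
  rewrite ltr_pdivrMr in Mx; last by lra.
  have ex := expR_ge1Dx x.
  have exN : expR (- x) < 1 by rewrite -expR0 ltr_expR; lra.
  have : (1 + x) * (1 + cos Th) <= expR x * (1 + cos Th).
    by rewrite ler_pM2r//; lra.
  have : expR (- x) * (1 - cos Th) <= 1 * (1 - cos Th).
    by rewrite ler_wpM2r//; lra.
  by rewrite /cosh /sinh; lra.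
have tc : t < cot_angle Th x y.
  apply: (le_lt_trans (ler_norm t)); rewrite ltr_pdivlMr//.
  apply: (@le_lt_trans _ _ `|t|); first by rewrite ler_piMr ?sin_le1.
  have coth1 : 1 <= cosh y / sinh y.
    by rewrite ler_pdivlMr ?sinh_gt0// mul1r ltW// sinh_lt_cosh.
  apply: (lt_le_trans num); rewrite lerD2r.
  by apply: ler_peMr coth1; exact/ltW/sinh_gt0.
have := lt_atan tc; rewrite /t tanK; last by rewrite in_itv/=; apply/andP; lra.
by rewrite /base_angle; lra.
Qed.

(** By the mean value theorem the increment is [(C - 1) * q / (1 + c ^+ 2)] for
    some [c >= q], and [2 * c <= 1 + c ^+ 2]; hence the bound is uniform in
    [q]. *)
Lemma atan_scale_le C q : 1 <= C -> 0 <= q ->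
  atan (C * q) - atan q <= (C - 1) / 2.
Proof.
move=> C1 q0; have qC : q <= C * q by rewrite ler_peMl.
have [|c /itvP cI ->] := MVT_segment qC (fun x _ => is_derive1_atan x).
  by apply: continuous_subspaceT => x; exact: continuous_atan.
have qc : q <= c by rewrite cI.
have d0 : 0 < 1 + c ^+ 2 by have := sqr_ge0 c; lra.
rewrite mulrC ler_pdivrMr//.
have : q * (C - 1) <= c * (C - 1) by rewrite ler_wpM2r; lra.
have : 0 <= (C - 1) * (c - 1) ^+ 2 by rewrite mulr_ge0 ?sqr_ge0//; lra.
by lra.
Qed.

Lemma cot_angle_diag Th x : 0 < Th < pi -> 0 < x ->
  cot_angle Th x x = cosh x * tan (pi / 2 - Th / 2).
Proof.
move=> T x0; have sx := sinh_gt0 x0.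
have s0 : 0 < sin (Th / 2) by apply: sin_gt0_pi; case/andP: T => *; lra.
have c0 : 0 < cos (Th / 2) by apply: cos_gt0_pihalf; case/andP: T => *; lra.
rewrite /tan sinB cosB cos_pihalf sin_pihalf /cot_angle.
have {1 2}-> : Th = (Th / 2) *+ 2 by rewrite -[RHS]mulr_natr; field.
rewrite sin_mulr2n cos_mulr2n; field.
by rewrite !lt0r_neq0.
Qed.

(** Half the area [Th - 2 * base_angle Th x x] of the isosceles triangle tends
    to 0 with [x], uniformly in [Th]. In the Euclidean limit the base angle is
    [Th / 2], of cotangent [q = tan (pi / 2 - Th / 2)]; the hyperbolic triangle
    only multiplies [q] by [cosh x]. *)
Lemma base_angle_diag_ge Th x : 0 < Th < pi -> 0 < x ->
  Th / 2 - (cosh x - 1) / 2 <= base_angle Th x x.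
Proof.
move=> T x0; rewrite /base_angle cot_angle_diag//.
have C1 : 1 <= cosh x.
  have := cosh_sqr x; have := sinh_lt_cosh x; have := sinh_gt0 x0; nra.
case/andP: T => T0 Tp.
have q0 : 0 <= tan (pi / 2 - Th / 2).
  rewrite divr_ge0//; [apply: sin_ge0_pi|apply: cos_ge0_pihalf]; apply/andP; lra.
have := atan_scale_le C1 q0; rewrite tanK; last by rewrite in_itv/=; apply/andP; lra.
by lra.
Qed.

End BaseAngle.

(** * Perron's method *)

(** A solution of [F v (r v) r = t] lying above a constant subsolution [e]. The
    second argument of [F] is the unknown at [v] itself, in which [F] is only
    continuous; the third is the unknown everywhere, [v] included, in which [F]
    is monotone. This separation covers loops, for which the vertex is its own
    neighbour: monotonicity is never applied to the diagonal [F v (r v) r], but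
    only with the second argument held fixed. *)
Lemma exists_level_of_subsolution (R : realType) (V : Type)
    (F : V -> R -> (V -> R) -> R) (t e : R) :
  0 < e ->
  (forall v x r s, 0 < x -> (forall w, 0 < r w) -> (forall w, r w <= s w) ->
     F v x r <= F v x s) ->
  (forall v r, continuous (fun x => F v x r)) ->
  (forall v, exists M, forall x r, M < x -> (forall w, 0 < r w) -> F v x r < t) ->
  (forall v, t <= F v e (fun=> e)) ->
  exists r : V -> R, (forall v, 0 < r v) /\ forall v, F v (r v) r = t.
Proof.
move=> e0 mono cont bnd sub.
(* The subsolutions above [e]. *)
pose A := [set r : V -> R |
  (forall v, e <= r v) /\ forall v, t <= F v (r v) r].
have pos r : A r -> forall v, 0 < r v.
  by move=> [er _] v; exact: lt_le_trans (er v).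
have Ae : A (fun=> e) by split.
pose vals v := [set r v | r in A].
have vals_sup v : has_sup (vals v).
  split; first by exists e, (fun=> e).
  have [M HM] := bnd v; exists M => _ [r Ar <-].
  by rewrite leNgt; apply/negP => /HM /(_ (pos _ Ar)); rewrite ltNge (Ar.2 v).
pose S v := sup (vals v).
have leS r v : A r -> r v <= S v.
  by move=> Ar; apply: sup_upper_bound => //; exists r.
have eS v : e <= S v := leS _ v Ae.
have S0 v : 0 < S v := lt_le_trans e0 (eS v).
(* The supremum is a subsolution: were [F v (S v) S] below [t], so would be
   [F v (r v) S] for some [r] in [A] with [r v] near [S v], and this bounds
   [F v (r v) r] above. *)
have tS v : t <= F v (S v) S.
  rewrite leNgt; apply/negP => lt_t.
  have /nbhs_ballP[d /= d0 Hd] : \forall z \near S v, F v z S < t.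
    exact: cvgr_lt (cont v S (S v)) _ lt_t.
  have [_ [r Ar <-] rS] := sup_adherent d0 (vals_sup v).
  have : F v (r v) S < t.
    apply: Hd; rewrite /ball/= ger0_norm ?subr_ge0 ?leS//.
    by rewrite -/(S v) in rS; lra.
  apply/negP; rewrite -leNgt (le_trans (Ar.2 v))// mono//; first exact: pos.
    exact: pos.
  by move=> w; exact: leS.
exists S; split=> // v; apply/eqP; rewrite eq_le tS andbT leNgt; apply/negP => gt_t.
(* Raising [S] slightly at [v] alone yields an element of [A] above [S]. *)
have /nbhs_ballP[d /= d0 Hd] : \forall z \near S v, t < F v z S.
    exact: cvgr_gt (cont v S (S v)) _ gt_t.
pose x := S v + d / 2.
pose S' w := if `[< w = v >] then x else S w.
have SS' w : S w <= S' w.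
  by rewrite /S'; case: asboolP => [->|//]; rewrite /x; lra.
suff /(leS _ v) : A S' by rewrite /S' asboolT// /x; lra.
split=> w; first exact: le_trans (SS' w).
have S'0 : 0 < S' w by exact: lt_le_trans (SS' w).
apply: le_trans (mono _ _ _ _ S'0 S0 SS').
rewrite /S'; case: asboolP => [->|_]; last exact: tS.
apply/ltW/Hd; rewrite /ball/= /x opprD addrA subrr add0r normrN gtr0_norm; lra.
Qed.

(** * Existence of the circle pattern *)

Theorem theorem1p10 (R : realType) (S : topologicalType)
    (D : cell_decomposition R S) (Theta : edge D -> R) :
  surface R S ->
  ~ compact [set: S] ->
  infinite_decomposition D ->
  skeleton_connected D ->
  (forall e : edge D, 0 < Theta e < pi) ->
  condition_C1 Theta ->
  (exists c : R, 0 < c /\ forall v : vert D, c <= mean_angle_excess Theta v) ->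
  exists r : vert D -> R, good_ideal_circle_pattern Theta r.
Proof.
move=> _ _ _ _ Tpi _ [c [c0 Hc]].
pose darts (v : vert D) := finmap.enum_fset (fset_set (star v)).
pose F v x (r : vert D -> R) : R :=
  \sum_(d <- darts v) base_angle (Theta d.1) x (r (edge_end d.1 (~~ d.2))).
suff [r [r0 Fr]] : exists r, (forall v, 0 < r v) /\ forall v, F v (r v) r = pi.
  exists r; split=> // v.
  rewrite /curvature fsbig_finite/=; last exact: star_finite.
  rewrite (eq_bigr (fun d => base_angle (Theta d.1) (r v)
      (r (edge_end d.1 (~~ d.2))))); last by move=> d _; exact: inner_angleE.
  by rewrite -/(darts v) -/(F v (r v) r) Fr subrr.
have sumE (v : vert D) (a : R) : \sum_(d <- darts v) a = (degree v)%:R * a.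
  by rewrite big_const_seq count_predT iter_addr_0 mulr_natl.
have deg_gt0 (v : vert D) : 0 < (degree v)%:R :> R.
  rewrite ltr0n lt0n; apply/negP => /eqP d0.
  by have := Hc v; rewrite /mean_angle_excess d0 invr0 mulr0 leNgt c0.
(* The error of [base_angle_diag_ge] at [e] is at most [c / 2] for each dart,
   and the values [Theta / 2] exceed a total of [pi] by [c / 2] for each dart. *)
have [e e0 ce] := exists_cosh_le c0.
apply: (exists_level_of_subsolution e0).
- move=> v x r s x0 r0 rs; apply: ler_sum => d _; exact: base_angle_le.
- move=> v r.
  apply: (continuous_big (op := +%R)); first exact: add_continuous.
  by move=> d _; exact: continuous_base_angle.
- move=> v.
  (* Half of the target, shared equally between the darts. *)
  pose eta : R := pi / 2 / (degree v)%:R.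
  have eta0 : 0 < eta by rewrite !divr_gt0// pi_gt0.
  have /choice[M HM] (d : edge D * bool) : exists M, 0 <= M /\
      forall x y, M < x -> 0 < y -> base_angle (Theta d.1) x y < eta.
    by have [M M0 HM] := base_angle_small (Tpi d.1) eta0; exists M.
  (* The thresholds are nonnegative, so their sum exceeds each of them. *)
  exists (\sum_(d <- darts v) M d) => x r Mx r0.
  apply: (@le_lt_trans _ _ (\sum_(d <- darts v) eta)); last first.
    rewrite sumE mulrC divfK ?gt_eqF//.
    by have := pi_gt0 R; lra.
  rewrite /F !big_seq ler_sum// => d dv.
  apply/ltW/(HM d).2 => //; apply: le_lt_trans Mx.
  rewrite (perm_big _ (perm_to_rem dv)) big_cons/= lerDl sumr_ge0// => d' _.
  exact: (HM d').1.
- move=> v.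
  have cv : c * (degree v)%:R <= angle_sum Theta v - 2 * pi.
    by rewrite -ler_pdivlMr//; exact: Hc.
  rewrite /angle_sum fsbig_finite/= in cv; last exact: star_finite.
  rewrite -/(darts v) in cv.
  apply: (@le_trans _ _ (\sum_(d <- darts v) (Theta d.1 / 2 - c / 2))).
    rewrite big_split/= -mulr_suml sumE; lra.
  apply: ler_sum => d _; apply: le_trans (base_angle_diag_ge (Tpi _) e0).
  lra.
Qed.
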